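(* Suppose $f:M\to N$ is a pluriharmonic map between Kähler manifolds. Then $\operatorname{div}S_\sigma=\operatorname{div}S_\tau=0$.
   Context: Let $(M,g,J)$, $(N,h,J')$ be Kähler manifolds and $f:M\to N$ smooth. The $f^{-1}TN$-valued 1-forms $\sigma,\tau$ are $\sigma(X)=\frac12\big(df(X)+J'df(JX)\big)$ and $\tau(X)=\frac12\big(df(X)-J'df(JX)\big)$, $X\in TM$. For an $f^{-1}TN$-valued 1-form $\omega$, the stress-energy tensor is $S_\omega(X,Y)=\frac{|\omega|^2}{2}g(X,Y)-\langle\omega(X),\omega(Y)\rangle$, where $f^{-1}TN$ carries the pull-back metric and connection and $|\omega|^2=\sum_A|\omega(e_A)|^2$ for an orthonormal basis $\{e_A\}$ of the real tangent space. The divergence of a 2-tensor field $T$ is $(\operatorname{div}T)(X)=\sum_A(\nabla_{e_A}T)(e_A,X)$. The map $f$ is pluriharmonic if its complexified second fundamental form satisfies $(\nabla df)(Z,\overline W)=0$ for all $Z,W\in T^{1,0}M$. *)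

(* Defs.v *)
From HB Require Import structures.
From mathcomp Require Import all_boot all_order all_algebra.
From mathcomp Require Import all_classical all_reals all_analysis.
From mathcomp Require Import complex.

Set Implicit Arguments.
Unset Strict Implicit.
Unset Printing Implicit Defensive.

Import Order.TTheory GRing.Theory Num.Theory.
Import numFieldNormedType.Exports.

Local Open Scope classical_set_scope.
Local Open Scope ring_scope.

(* Conventions.  A tangent vector is, in a chart, the row vector of its
   components in the coordinate frame, and a linear map acts on the right:
   the value of D at u is u *m D.  Row A of a matrix E is the A-th vector
   of the frame E. *)

Definition pder (R : realType) (d : nat) (V : normedModType R) (i : 'I_d)
    (F : 'rV[R]_d -> V) (x : 'rV[R]_d) : V :=
  'D_(delta_mx 0 i) F x.

Fixpoint Ck (R : realType) (d : nat) (V : normedModType R) (k : nat)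
    (U : set 'rV[R]_d) (F : 'rV[R]_d -> V) : Prop :=
  match k with
  | 0 => forall x, U x -> {for x, continuous F}
  | k'.+1 => (forall x, U x -> differentiable F x) /\
             (forall i : 'I_d, Ck k' U (pder i F))
  end.

(* Meaningful for open U, the only case in which it is used. *)
Definition smooth_on (R : realType) (d : nat) (V : normedModType R)
    (U : set 'rV[R]_d) (F : 'rV[R]_d -> V) : Prop :=
  forall k, Ck k U F.

(* The complex structure of C^m in the real coordinates
   (x_1, ..., x_m, y_1, ..., y_m): d/dx_i |-> d/dy_i, d/dy_i |-> - d/dx_i. *)
Definition J0 (R : realType) (m : nat) : 'M[R]_(m + m) :=
  block_mx 0 1%:M (- 1%:M) 0.

(* Holomorphic = smooth with complex linear differential
   (the Cauchy-Riemann equations). *)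
Definition holomorphic_on (R : realType) (m n : nat) (U : set 'rV[R]_(m + m))
    (F : 'rV[R]_(m + m) -> 'rV[R]_(n + n)) : Prop :=
  smooth_on U F /\
  forall x, U x -> J0 R m *m jacobian F x = jacobian F x *m J0 R n.

Record complexManifold (R : realType) (m : nat) := ComplexManifold {
  carrier :> topologicalType ;
  cm_hausdorff : hausdorff_space carrier ;
  cm_countable : @second_countable carrier ;
  chart_index : Type ;
  chart_dom : chart_index -> set carrier ;
  chart : chart_index -> carrier -> 'rV[R]_(m + m) ;
  (* only the values on the image of the chart matter *)
  chart_inv : chart_index -> 'rV[R]_(m + m) -> carrier ;
  chart_cover : forall p, exists i, chart_dom i p ;
  chart_dom_open : forall i, open (chart_dom i) ;
  chart_img_open : forall i, open (chart i @` chart_dom i) ;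
  chartK : forall i p, chart_dom i p -> chart_inv i (chart i p) = p ;
  chart_continuous : forall i p, chart_dom i p -> {for p, continuous (chart i)} ;
  chart_inv_continuous : forall i x,
    (chart i @` chart_dom i) x -> {for x, continuous (chart_inv i)} ;
  chart_transition : forall i j,
    holomorphic_on (chart i @` (chart_dom i `&` chart_dom j))
                   (chart j \o chart_inv i)
}.

Definition inner (R : realType) (d : nat) (G : 'M[R]_d) (u v : 'rV[R]_d) : R :=
  (u *m G *m v^T) 0 0.

(* The fundamental 2-form omega(X, Y) = g(JX, Y). *)
Definition fundamental_form (R : realType) (m : nat)
    (g : 'rV[R]_(m + m) -> 'M[R]_(m + m)) (x : 'rV[R]_(m + m)) : 'M[R]_(m + m) :=
  J0 R m *m g x.

(* A complex manifold with a Hermitian metric (given by its components in each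
   chart) whose fundamental form is closed.  The complex structure J has the
   constant matrix J0 in every chart. *)
Record kahlerManifold (R : realType) (m : nat) := KahlerManifold {
  km_complex :> complexManifold R m ;
  metric : chart_index km_complex -> 'rV[R]_(m + m) -> 'M[R]_(m + m) ;
  metric_smooth : forall i,
    smooth_on (chart i @` chart_dom i) (metric i) ;
  metric_transition : forall i j x,
    (chart i @` (chart_dom i `&` chart_dom j)) x ->
    let phi := chart j \o chart_inv i in
    metric i x = jacobian phi x *m metric j (phi x) *m (jacobian phi x)^T ;
  metric_sym : forall i x, (chart i @` chart_dom i) x ->
    (metric i x)^T = metric i x ;
  metric_pos : forall i x, (chart i @` chart_dom i) x ->
    forall u, u != 0 -> 0 < inner (metric i x) u u ;
  metric_hermitian : forall i x, (chart i @` chart_dom i) x ->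
    forall u v, inner (metric i x) (u *m J0 R m) (v *m J0 R m) =
                inner (metric i x) u v ;
  metric_closed : forall i x, (chart i @` chart_dom i) x ->
    forall a b c : 'I_(m + m), let omega := fundamental_form (metric i) in
    pder a omega x b c + pder b omega x c a + pder c omega x a b = 0
}.

(* Gamma^k_ij of the Levi-Civita connection. *)
Definition christoffel (R : realType) (d : nat) (g : 'rV[R]_d -> 'M[R]_d)
    (x : 'rV[R]_d) (i j k : 'I_d) : R :=
  2^-1 * \sum_l invmx (g x) k l *
                (pder i g x j l + pder j g x i l - pder l g x i j).

(* Some orthonormal basis of the tangent space at x; the quantities
   defined from it below do not depend on which one is picked. *)
Definition orthonormal_basis (R : realType) (d : nat)
    (g : 'rV[R]_d -> 'M[R]_d) (x : 'rV[R]_d) : 'M[R]_d :=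
  xget 0 [set E : 'M[R]_d |
    forall a b, inner (g x) (row a E) (row b E) = (a == b)%:R].

(* Entry (j, k) is (nabla_i T)(d_j, d_k), d_i being the i-th coordinate vector. *)
Definition cov2 (R : realType) (d : nat) (g : 'rV[R]_d -> 'M[R]_d)
    (T : 'rV[R]_d -> 'M[R]_d) (i : 'I_d) (x : 'rV[R]_d) : 'M[R]_d :=
  \matrix_(j, k) (pder i T x j k
    - \sum_l christoffel g x i j l * T x l k
    - \sum_l christoffel g x i k l * T x j l).

Definition div (R : realType) (d : nat) (g : 'rV[R]_d -> 'M[R]_d)
    (T : 'rV[R]_d -> 'M[R]_d) (x : 'rV[R]_d) (X : 'rV[R]_d) : R :=
  let E := orthonormal_basis g x in
  \sum_A inner (\sum_i E A i *: cov2 g T i x) (row A E) X.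

(* Forms with values in the pull-back bundle, in a chart of M and a chart of N:
   g and h are the local expressions of the metrics, F that of the map, and row
   j of w x is the value of the form at the j-th coordinate vector. *)

(* Entry (j, a) is the a-th component of (nabla_i w)(d_j), for the connection induced by the Levi-Civita connection of g
   and the pull-back by F of the Levi-Civita connection of h. *)
Definition cov1 (R : realType) (d e : nat) (g : 'rV[R]_d -> 'M[R]_d)
    (h : 'rV[R]_e -> 'M[R]_e) (F : 'rV[R]_d -> 'rV[R]_e)
    (w : 'rV[R]_d -> 'M[R]_(d, e)) (i : 'I_d) (x : 'rV[R]_d) : 'M[R]_(d, e) :=
  \matrix_(j, a) (pder i w x j a
    - \sum_k christoffel g x i j k * w x k a
    + \sum_b \sum_c christoffel h (F x) b c a * pder i F x 0 b * w x j c).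

Definition normsq (R : realType) (d e : nat) (g : 'rV[R]_d -> 'M[R]_d)
    (h : 'rV[R]_e -> 'M[R]_e) (F : 'rV[R]_d -> 'rV[R]_e)
    (w : 'rV[R]_d -> 'M[R]_(d, e)) (x : 'rV[R]_d) : R :=
  let E := orthonormal_basis g x in
  \sum_A inner (h (F x)) (row A E *m w x) (row A E *m w x).

Definition stress (R : realType) (d e : nat) (g : 'rV[R]_d -> 'M[R]_d)
    (h : 'rV[R]_e -> 'M[R]_e) (F : 'rV[R]_d -> 'rV[R]_e)
    (w : 'rV[R]_d -> 'M[R]_(d, e)) (x : 'rV[R]_d) : 'M[R]_d :=
  \matrix_(j, k) (normsq g h F w x / 2 * g x j k
                  - inner (h (F x)) (row j (w x)) (row k (w x))).

Definition sigma (R : realType) (m n : nat)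
    (F : 'rV[R]_(m + m) -> 'rV[R]_(n + n)) (x : 'rV[R]_(m + m)) :
    'M[R]_(m + m, n + n) :=
  2^-1 *: (jacobian F x + J0 R m *m jacobian F x *m J0 R n).

Definition tau (R : realType) (m n : nat)
    (F : 'rV[R]_(m + m) -> 'rV[R]_(n + n)) (x : 'rV[R]_(m + m)) :
    'M[R]_(m + m, n + n) :=
  2^-1 *: (jacobian F x - J0 R m *m jacobian F x *m J0 R n).

Definition complexify (R : realType) (p q : nat) (A : 'M[R]_(p, q)) :
    'M[R[i]]_(p, q) :=
  map_mx (real_complex R) A.

(* Complex bilinear extension of the second fundamental form nabla dF. *)
Definition second_fundC (R : realType) (d e : nat) (g : 'rV[R]_d -> 'M[R]_d)
    (h : 'rV[R]_e -> 'M[R]_e) (F : 'rV[R]_d -> 'rV[R]_e) (x : 'rV[R]_d)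
    (Z W : 'rV[R[i]]_d) : 'rV[R[i]]_e :=
  \sum_i Z 0 i *: (W *m complexify (cov1 g h F (jacobian F) i x)).

(* Vectors of type (1,0): J Z = i Z. *)
Definition T10 (R : realType) (m : nat) (Z : 'rV[R[i]]_(m + m)) : Prop :=
  Z *m complexify (J0 R m) = 'i%C *: Z.

Section Maps.
Context {R : realType} {m n : nat}.
Context {M : kahlerManifold R m} {N : kahlerManifold R n}.

Definition local_rep (f : M -> N) (i : chart_index M) (j : chart_index N) :
    'rV[R]_(m + m) -> 'rV[R]_(n + n) :=
  chart j \o f \o chart_inv i.

Definition smooth_map (f : M -> N) : Prop :=
  continuous f /\
  forall i j, smooth_on (chart i @` (chart_dom i `&` f @^-1` chart_dom j))
                        (local_rep f i j).

Definition pluriharmonic (f : M -> N) : Prop :=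
  forall i j p, chart_dom i p -> chart_dom j (f p) ->
  forall Z W : 'rV[R[i]]_(m + m), T10 Z -> T10 W ->
  second_fundC (metric i) (metric j) (local_rep f i j) (chart i p)
    Z (map_mx conjc W) = 0.

(* div S_w = 0 on M, where w assigns to a map its 1-form in coordinates
   (sigma or tau). *)
Definition div_stress_zero
    (w : ('rV[R]_(m + m) -> 'rV[R]_(n + n)) ->
         'rV[R]_(m + m) -> 'M[R]_(m + m, n + n))
    (f : M -> N) : Prop :=
  forall i j p, chart_dom i p -> chart_dom j (f p) ->
  forall X : 'rV[R]_(m + m),
  let F := local_rep f i j in
  div (metric i) (stress (metric i) (metric j) F (w F)) (chart i p) X = 0.

End Maps.

(* Main.v *)
Require Import Defs.
From mathcomp Require Import all_boot all_order all_algebra.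
From mathcomp Require Import all_classical all_reals all_analysis.
From mathcomp Require Import complex ring lra.

(* For a form w with values in the pull-back bundle,
     (div S_w)(X) = <nabla_X w, w> - <sum_A (nabla_{e_A} w)(e_A), w(X)>
                    - sum_A <w(e_A), (nabla_{e_A} w)(X)>.
   Since J and J' are parallel, nabla sigma and nabla tau are the combinations
   N(X, Y) = (B(X, Y) +- J' B(X, JY)) / 2 of the second fundamental form B.
   Pluriharmonicity says B(JX, Y) = B(X, JY); with the symmetry of B this makes
   N symmetric, so the first and last terms cancel, and N(JX, JY) = - N(X, Y),
   so the trace of N, hence the middle term, vanishes.

   In a chart, with P the inverse of the metric G, H the metric of the target
   along the map and W the matrix of w, |w|^2 = tr (P W H W^T) whichever
   orthonormal frame is used. *)

Set Implicit Arguments.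
Unset Strict Implicit.
Unset Printing Implicit Defensive.

Import Order.TTheory GRing.Theory Num.Theory.
Import numFieldNormedType.Exports.

Local Open Scope classical_set_scope.
Local Open Scope ring_scope.


(** * Differential calculus of matrix-valued functions *)

Section MatrixDerivative.
Context {R : realFieldType} {V : normedModType R}.
Implicit Types (x v : V).

Lemma is_derive_mxP p q (A : V -> 'M[R]_(p, q)) x v (dA : 'M[R]_(p, q)) :
  is_derive x v A dA <-> forall i j, is_derive x v (fun y => A y i j) (dA i j).
Proof.
split=> [[dfA <-] i j|dfA].
  by apply: DeriveDef; [exact: (derivable_mxP _ _ _).1|rewrite derive_mx// mxE].
have dA' : derivable A x v by apply/derivable_mxP => i j; have [] := dfA i j.
apply: DeriveDef => //; rewrite derive_mx//.
by apply/matrixP => i j; rewrite mxE; have [] := dfA i j.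
Qed.

Lemma is_derive_bigsum (I : Type) (r : seq I) (h : I -> V -> R) x v
    (dh : I -> R) : (forall i, is_derive x v (h i) (dh i)) ->
  is_derive x v (fun y => \sum_(i <- r) h i y) (\sum_(i <- r) dh i).
Proof.
move=> hi; elim: r => [|a r IH].
  rewrite big_nil (_ : (fun _ => _) = cst 0); first exact: is_derive_cst.
  by apply/funext => y; rewrite big_nil.
rewrite big_cons (_ : (fun _ => _) = h a + (fun y => \sum_(i <- r) h i y)).
  exact: is_deriveD.
by apply/funext => y; rewrite big_cons.
Qed.

Lemma derivable_bigsum (I : Type) (r : seq I) (h : I -> V -> R) x v :
  (forall i, derivable (h i) x v) ->
  derivable (fun y => \sum_(i <- r) h i y) x v.
Proof.
by move=> hi; have [] := is_derive_bigsum r (fun i => derivableP (hi i)).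
Qed.

Lemma is_derive_mulmx p q r (A : V -> 'M[R]_(p, q)) (B : V -> 'M[R]_(q, r))
    x v dA dB : is_derive x v A dA -> is_derive x v B dB ->
  is_derive x v (fun y => A y *m B y) (dA *m B x + A x *m dB).
Proof.
move=> /is_derive_mxP hA /is_derive_mxP hB; apply/is_derive_mxP => i j.
rewrite (_ : (fun _ => _) = (fun y => \sum_k A y i k * B y k j)); last first.
  by apply/funext => y; rewrite mxE.
rewrite !mxE -big_split/=; apply: is_derive_bigsum => k.
by apply: is_derive_eq; rewrite /GRing.scale/= addrC (mulrC (B x k j)).
Qed.

Lemma is_derive_trmx p q (A : V -> 'M[R]_(p, q)) x v dA :
  is_derive x v A dA -> is_derive x v (fun y => (A y)^T) dA^T.
Proof.
move=> /is_derive_mxP hA; apply/is_derive_mxP => i j.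
by rewrite mxE; under eq_fun do rewrite mxE.
Qed.

Lemma is_derive_mxtrace p (A : V -> 'M[R]_p) x v dA :
  is_derive x v A dA -> is_derive x v (fun y => \tr (A y)) (\tr dA).
Proof. by move=> /is_derive_mxP hA; apply: is_derive_bigsum. Qed.

Lemma is_derive_scalemx p q (a : V -> R) (A : V -> 'M[R]_(p, q)) x v da dA :
  is_derive x v a da -> is_derive x v A dA ->
  is_derive x v (fun y => a y *: A y) (da *: A x + a x *: dA).
Proof.
move=> ha /is_derive_mxP hA; apply/is_derive_mxP => i j.
under eq_fun do rewrite mxE; rewrite !mxE.
by apply: is_derive_eq; rewrite /GRing.scale/= addrC (mulrC (A x i j)).
Qed.

(** Induction on the size: Laplace expansion along the first row reduces the determinant to
    minors. *)
Lemma derivable_det p (A : V -> 'M[R]_p) x v :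
  derivable A x v -> derivable (fun y => \det (A y)) x v.
Proof.
elim: p A => [|p IH] A /derivable_mxP hA.
  by under eq_fun do rewrite det_mx00; exact: derivable_cst.
under eq_fun do rewrite (expand_det_row _ ord0).
apply: derivable_bigsum => j; apply: derivableM => //.
apply: derivableM; first exact: derivable_cst.
apply: IH; apply/derivable_mxP => a b.
by under eq_fun do rewrite !mxE; exact: hA.
Qed.

(** Cramer's rule: near [x] the inverse is the adjugate divided by the determinant, and both are
    polynomial in the entries. *)
Lemma derivable_invmx p (A : V -> 'M[R]_p) x v :
  (\near x, A x \in unitmx) ->
  derivable A x v -> derivable (fun y => invmx (A y)) x v.
Proof.
move=> uA dA.
have ux := nbhs_singleton uA.
(* [invmx] follows Cramer's formula only on invertible matrices and returns its argument elsewhere,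
   so the two functions are compared near [x] only. *)
apply: (@near_eq_derivable _ _ _ (fun y => (\det (A y))^-1 *: \adj (A y))).
  by near=> y; rewrite /invmx (near uA).
apply/derivable_mxP => i j; under eq_fun do rewrite !mxE.
apply: derivableM.
  apply: derivableV; last exact: derivable_det.
  by rewrite -unitfE; rewrite unitmxE in ux.
apply: derivableM; first exact: derivable_cst.
apply: derivable_det; apply/derivable_mxP => a b; under eq_fun do rewrite !mxE.
exact: (derivable_mxP _ _ _).1.
Unshelve. all: by end_near. Qed.

(** Differentiate [invmx (A y) *m A y], which is constantly 1 near [x], and solve for the derivative
    of the inverse. *)
Lemma is_derive_invmx p (A : V -> 'M[R]_p) x v dA :
  (\near x, A x \in unitmx) -> is_derive x v A dA ->
  is_derive x v (fun y => invmx (A y)) (- (invmx (A x) *m dA *m invmx (A x))).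
Proof.
move=> uA hA; have ux := nbhs_singleton uA.
have /derivableP hI := derivable_invmx uA (@ex_derive _ _ _ _ _ _ _ hA).
apply: is_derive_eq.
have h1 := is_derive_mulmx hI hA.
have h2 : is_derive x v (fun y => invmx (A y) *m A y) 0.
  apply: (@near_eq_is_derive _ _ _ (cst 1%:M)).
  by near=> y; rewrite mulVmx// (near uA).
have := @derive_val _ _ _ _ _ _ _ h1; rewrite (@derive_val _ _ _ _ _ _ _ h2).
move/esym/eqP; rewrite addr_eq0 => /eqP /(congr1 (mulmx^~ (invmx (A x)))).
by rewrite /= mulNmx -[X in X = _]mulmxA mulmxV// mulmx1.
Unshelve. all: by end_near. Qed.

End MatrixDerivative.

(** * Symmetry of mixed second derivatives *)

Section Schwarz.
Context {R : realType} {V : normedModType R}.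

Lemma is_derive_line (f : V -> R) (x v : V) (t : R) :
  derivable f (x + t *: v) v ->
  is_derive t 1 (fun s : R => f (x + s *: v)) ('D_v f (x + t *: v)).
Proof.
have E : (fun h : R => h^-1 *: (f (h *: v + (x + t *: v)) - f (x + t *: v))) =
    (fun h : R => h^-1 *: (f (x + (h *: (1 : R) + t) *: v) - f (x + t *: v))).
  apply/funext => h; congr (_ *: (f _ - _)).
  by rewrite [_%:A]mulr1 scalerDl addrCA.
move=> df; apply: DeriveDef; first by move: df; rewrite /derivable E.
by rewrite /derive E.
Qed.

Lemma mean_value_line (f : V -> R) (x v : V) (h : R) : 0 < h ->
  (forall s, 0 <= s <= h -> derivable f (x + s *: v) v) ->
  exists2 s, 0 <= s <= h & f (x + h *: v) - f x = 'D_v f (x + s *: v) * h.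
Proof.
move=> h0 df.
have := @MVT R (fun s => f (x + s *: v)) (fun s => 'D_v f (x + s *: v)) 0 h h0.
case.
- move=> s; rewrite in_itv/= => /andP[s0 sh].
  by apply: is_derive_line; apply: df; rewrite !ltW.
- apply: derivable_within_continuous => s; rewrite in_itv/= => sh.
  by have [] := is_derive_line (df _ sh).
- move=> s; rewrite in_itv/= => /andP[s0 sh]; rewrite scale0r addr0 subr0 => ->.
  by exists s => //; rewrite !ltW.
Qed.

(** Two applications of the mean value theorem: to [y |-> f (y + h *: b) - f y] along [a], then to
    ['D_a f] along [b]. *)
Lemma second_difference (f : V -> R) (x a b : V) (h : R) : 0 < h ->
  (forall s t, 0 <= s <= h -> 0 <= t <= h ->
     let y := x + s *: a + t *: b in
     derivable f y a /\ derivable ('D_a f) y b) ->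
  exists s t, [/\ 0 <= s <= h, 0 <= t <= h &
   f (x + h *: a + h *: b) - f (x + h *: a) - (f (x + h *: b) - f x) =
   'D_b ('D_a f) (x + s *: a + t *: b) * h * h].
Proof.
move=> h0 df; have h00 : 0 <= (0 : R) <= h by rewrite lexx ltW.
have hh : 0 <= h <= h by rewrite lexx ltW.
pose g y := f (y + h *: b) - f y.
have dg s : 0 <= s <= h -> is_derive (x + s *: a) a g
    ('D_a f (x + s *: a + h *: b) - 'D_a f (x + s *: a)).
  move=> sh; have [d1 _] := df s h sh hh; have [d2 _] := df s 0 sh h00.
  rewrite scale0r addr0 in d2.
  apply: is_deriveB; last exact: derivableP.
  have E y : 
      (fun r : R => r^-1 *: (f ((r *: a + y) + h *: b) - f (y + h *: b))) =
      (fun r : R => r^-1 *: (f (r *: a + (y + h *: b)) - f (y + h *: b))).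
    by apply/funext => r; rewrite addrA.
  split; first by move: d1; rewrite /derivable /comp/= -E.
  by rewrite /derive E.
have [s sh e1] := mean_value_line h0
  (fun s sh => @ex_derive _ _ _ _ _ _ _ (dg s sh)).
have [t th e2] := mean_value_line h0 (fun t th => (df s t sh th).2).
exists s, t; split => //; rewrite -e2.
by have [_ <-] := dg s sh; rewrite -e1.
Qed.

(** The second difference is symmetric in [a] and [b], so the two mixed derivatives take a common
    value at two points arbitrarily close to [x]; continuity at [x] concludes. *)
Lemma derive_comm (f : V -> R) (x a b : V) :
  (\forall y \near x, [/\ derivable f y a, derivable f y b,
     derivable ('D_a f) y b & derivable ('D_b f) y a]) ->
  {for x, continuous ('D_b ('D_a f))} -> {for x, continuous ('D_a ('D_b f))} ->
  'D_b ('D_a f) x = 'D_a ('D_b f) x.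
Proof.
move=> df c1 c2; apply/eqP; rewrite -subr_eq0 -normr_eq0 eq_le normr_ge0 andbT.
apply/ler_addgt0Pl => e e0; rewrite addr0.
have tri (u w z : R) : `|u - z| <= e / 2 -> `|w - z| <= e / 2 -> `|u - w| <= e.
  move=> uz wz; rewrite -(subrKA z) (le_trans (ler_normD _ _))//.
  by rewrite (splitr e) lerD// distrC.
have e20 : 0 < e / 2 by rewrite divr_gt0.
have /cvgrPdist_le/(_ _ e20) n1 := c1.
have /cvgrPdist_le/(_ _ e20) n2 := c2.
have [r /= r0 B] := (nbhs_ballP _ _).1 (filterI df (filterI n1 n2)).
(* The step [h] satisfies [h * M = r / 2], which keeps the parallelogram spanned by [h *: a] and
   [h *: b] inside the ball of radius [r]. The summand 1 makes [M] positive even when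
   [a = b = 0]. *)
pose M := `|a| + `|b| + 1.
have M0 : 0 < M by rewrite ltr_wpDl// addr_ge0.
pose h := r / M / 2.
have h0 : 0 < h by rewrite !divr_gt0.
have hb u w s t : `|u| + `|w| + 1 = M ->
    0 <= s <= h -> 0 <= t <= h -> ball x r (x + s *: u + t *: w).
  move=> E /andP[s0 sh] /andP[t0 th]; rewrite -ball_normE/= -addrA opprD addrA.
  rewrite subrr sub0r normrN (le_lt_trans (ler_normD _ _))// !normrZ.
  rewrite !ger0_norm//.
  apply: (@le_lt_trans _ _ (h * (M - 1))).
    rewrite -E addrK mulrDr; apply: lerD; exact: ler_wpM2r.
  apply: (@lt_le_trans _ _ (h * M)); first by rewrite ltr_pM2l// ltrBlDr ltrDl.
  rewrite /h mulrAC divfK ?gt_eqF// ler_pdivrMr// ler_peMr ?ltW//.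
  by rewrite ltr1n.
have Mba : `|b| + `|a| + 1 = M by rewrite /M (addrC `|b|).
have dab s t : 0 <= s <= h -> 0 <= t <= h -> let y := x + s *: a + t *: b in
    derivable f y a /\ derivable ('D_a f) y b.
  move=> sh th; have [[da _ dab _] _] := B _ (hb a b s t erefl sh th).
  exact: conj da dab.
have dba s t : 0 <= s <= h -> 0 <= t <= h -> let y := x + s *: b + t *: a in
    derivable f y b /\ derivable ('D_b f) y a.
  move=> sh th; have [[_ db _ dba] _] := B _ (hb b a s t Mba sh th).
  exact: conj db dba.
have [s [t [sh th e1]]] := second_difference h0 dab.
have [s' [t' [sh' th' e2]]] := second_difference h0 dba.
have E : 'D_b ('D_a f) (x + s *: a + t *: b) =
    'D_a ('D_b f) (x + s' *: b + t' *: a).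
  apply: (mulIf (lt0r_neq0 h0)); apply: (mulIf (lt0r_neq0 h0)).
  apply: etrans (esym e1) (etrans _ e2).
  rewrite (addrAC x (h *: b)) !opprB.
  by rewrite [LHS]addrACA [RHS]addrACA; congr (_ + _); rewrite addrC.
have [_ [q1 _]] := B _ (hb a b s t erefl sh th).
have [_ [_ q2]] := B _ (hb b a s' t' Mba sh' th').
rewrite E in q1.
exact: tri q1 q2.
Qed.

End Schwarz.


(** * Existence of orthonormal frames *)

Section Gram.
Context {R : realType}.

Lemma inner_row d (G : 'M[R]_d) p q (A : 'M[R]_(p, d)) (B : 'M[R]_(q, d)) a b :
  inner G (row a A) (row b B) = (A *m G *m B^T) a b.
Proof.
by rewrite /inner -row_mul mxE [RHS]mxE; apply: eq_bigr => k _; rewrite !mxE.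
Qed.

(* Cholesky: split off the first row and apply induction to the Schur
   complement. *)
Lemma positive_orthonormal d (G : 'M[R]_d) : G^T = G ->
  (forall u, u != 0 -> 0 < inner G u u) ->
  exists E : 'M[R]_d, E *m G *m E^T = 1%:M.
Proof.
elim: d G => [|d IH] G symG posG.
  by exists 0; apply/matrixP => -[].
move: G symG posG; rewrite -[d.+1]/(1 + d)%N => G symG posG.
pose b := ursubmx G; pose al : R := ulsubmx G 0 0.
have Ea : ulsubmx G = al%:M by rewrite [LHS]mx11_scalar.
have Eb : dlsubmx G = b^T by rewrite /b trmx_ursub symG.
have EG : G = block_mx al%:M b b^T (drsubmx G) by rewrite -Ea -Eb submxK.
set C := drsubmx G in EG.
have symC : C^T = C by rewrite /C trmx_drsub symG.
have al0 : 0 < al.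
  have := posG (row_mx 1%:M 0); rewrite {1}/inner EG.
  rewrite mul_row_block tr_row_mx mul_row_col !mul0mx !addr0 trmx0 mulmx0 addr0.
  rewrite mul1mx trmx1 mulmx1 mxE eqxx; apply.
  by rewrite row_mx_eq0 negb_and oner_neq0.
pose S := C - al^-1 *: (b^T *m b).
have symS : S^T = S.
  by rewrite /S linearB/= linearZ/= trmx_mul trmxK symC.
have posS u : u != 0 -> 0 < inner S u u.
  move=> u0.
  (* The first coordinate is chosen to make this vector [G]-orthogonal to the first basis vector, so
     that its [G]-norm is the [S]-norm of [u]. *)
  have := posG (row_mx (- al^-1 *: (u *m b^T)) u).
  rewrite row_mx_eq0 negb_and u0 orbT => /(_ isT).
  rewrite {1}/inner EG mul_row_block tr_row_mx mul_row_col mul_mx_scalar.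
  rewrite scalerA mulrN mulfV ?gt_eqF// scaleN1r addNr mul0mx add0r.
  by rewrite /inner /S mulmxBr -scalemxAr -scalemxAl mulmxA scaleNr addrC.
have [E hE] := IH S symS posS.
pose s := Num.sqrt al.
have s0 : s != 0 by rewrite gt_eqF// sqrtr_gt0.
have ss : s * s = al by rewrite -expr2 sqr_sqrtr// ltW.
have aln0 : al != 0 by rewrite gt_eqF.
(* The first basis vector normalised, followed by the frame [E] of the Schur complement, with the
   same orthogonal correction. *)
exists (block_mx (s^-1)%:M 0 (- al^-1 *: (E *m b^T)) E).
rewrite EG mulmx_block !mul0mx !addr0 tr_block_mx mulmx_block.
rewrite !mul_mx_scalar !mul_scalar_mx !scalerA !tr_scalar_mx !trmx0 !mulmx0.
rewrite !addr0 mulrN mulfV// scaleN1r addNr !mul0mx !add0r.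
rewrite (scalar_mx_block 1) !linearZ/= trmx_mul trmxK.
congr block_mx.
  rewrite -!scalemxAl -scalar_mxM scale_scalar_mx -ss; congr (_%:M).
  by field.
- rewrite -!scalemxAl mul_scalar_mx !scalerA -scalerDl.
  rewrite (_ : _ + _ = 0) ?scale0r//.
  by field; rewrite aln0 s0.
- rewrite -hE /S mulmxBr mulmxBl -scalemxAr -!scalemxAl !mulmxA scaleNr mulmxDl.
  by rewrite mulNmx -scalemxAl addrC.
Qed.

Lemma positive_unitmx d (G : 'M[R]_d) : G^T = G ->
  (forall u, u != 0 -> 0 < inner G u u) -> G \in unitmx.
Proof.
move=> symG /(positive_orthonormal symG)[E].
by rewrite -mulmxA => /mulmx1_unit[_]; rewrite unitmx_mul => /andP[].
Qed.

(** From [E G E^T = 1] it follows that [G E^T] is also a left inverse of [E], whence [E^T E] inverts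
    [G]. This removes the choice of the frame from every later formula. *)
Lemma orthonormal_basisP d (g : 'rV[R]_d -> 'M[R]_d) x : (g x)^T = g x ->
  (forall u, u != 0 -> 0 < inner (g x) u u) ->
  (orthonormal_basis g x)^T *m orthonormal_basis g x = invmx (g x).
Proof.
move=> symG posG.
have uG := positive_unitmx symG posG.
rewrite /orthonormal_basis; set P := [set E | _].
(* Existence has to be established first, since [xget] falls back to 0 on an empty set. *)
have /xgetPex : exists E, P E.
  have [E hE] := positive_orthonormal symG posG; exists E => a b.
  by rewrite inner_row hE mxE.
move=> /(_ 0); set E := xget _ _ => hE.
have : E *m (g x *m E^T) = 1%:M.
  by rewrite mulmxA; apply/matrixP => a b; rewrite -inner_row hE mxE.
move=> /mulmx1C hE'.
rewrite -[LHS]mul1mx -(mulVmx uG) -[LHS]mulmxA mulmxA -!mulmxA.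
by rewrite (mulmxA (g x)) hE' mulmx1.
Qed.

End Gram.


(** * Norm and divergence without frames *)

Section Trace.
Context {R : realType}.

(** The frames picked at different points are unrelated, so [normsq] can be differentiated only in
    this form. *)
Lemma normsqE d e (g : 'rV[R]_d -> 'M[R]_d) (h : 'rV[R]_e -> 'M[R]_e)
    (F : 'rV[R]_d -> 'rV[R]_e) (w : 'rV[R]_d -> 'M[R]_(d, e)) x :
  (g x)^T = g x -> (forall u, u != 0 -> 0 < inner (g x) u u) ->
  normsq g h F w x = \tr (invmx (g x) *m (w x *m h (F x) *m (w x)^T)).
Proof.
move=> symG posG; rewrite -(orthonormal_basisP symG posG) mxtrace_mulC.
rewrite [in RHS]mulmxA mxtrace_mulC /normsq; apply: eq_bigr => A _.
by rewrite -!row_mul inner_row trmx_mul !mulmxA.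
Qed.

(** The frame enters through [\sum_A E A i * E A k] alone, which is the [(i, k)] entry of the
    inverse metric. *)
Lemma divE d (g : 'rV[R]_d -> 'M[R]_d) (T : 'rV[R]_d -> 'M[R]_d) x X :
  (g x)^T = g x -> (forall u, u != 0 -> 0 < inner (g x) u u) ->
  div g T x X = (\sum_i row i (invmx (g x)) *m cov2 g T i x *m X^T) 0 0.
Proof.
move=> symG posG; rewrite -(orthonormal_basisP symG posG).
rewrite /div; set E := orthonormal_basis g x.
transitivity ((\sum_A row A E *m (\sum_i E A i *: cov2 g T i x) *m X^T) 0 0).
  by rewrite summxE.
under eq_bigr => A _ do rewrite mulmx_sumr mulmx_suml.
rewrite exchange_big/=; congr (fun_of_matrix _ 0 0); apply: eq_bigr => i _.
rewrite -!mulmx_suml; congr (_ *m _).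
under eq_bigr => A _ do rewrite -scalemxAr scalemxAl.
rewrite -mulmx_suml; congr (_ *m _).
rewrite row_mul mulmx_sum_row; apply: eq_bigr => A _.
by rewrite !mxE.
Qed.

End Trace.

(** * Pointwise algebra: contraction of the covariant derivative of the stress tensor *)

Section Divergence.
Context {R : realFieldType} (d e : nat).
Variables (G P J : 'M[R]_d) (H : 'M[R]_e) (W : 'M[R]_(d, e)).
Variable N : 'I_d -> 'M[R]_(d, e).
Hypotheses (PG : P *m G = 1%:M) (symP : P^T = P) (symH : H^T = H).
Hypotheses (JPJ : J^T *m P *m J = P) (JJ : J *m J = - 1%:M).
Hypothesis symN : forall i j, row j (N i) = row i (N j).
Hypothesis NJ : forall i, \sum_k J i k *: N k = J *m N i.

(* P is J-invariant whereas N(JX, JY) = - N(X, Y). *)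
Lemma trace_eq0 : \sum_i row i P *m N i = 0.
Proof.
set V := LHS.
suff VN : V = - V.
  apply/eqP; have : V *+ 2 == 0 by rewrite mulr2n {1}VN addNr.
  by rewrite -scaler_nat scaler_eq0 pnatr_eq0.
(* Substitute [P = J^T P J]; then [NJ] brings a second [J] next to the first, and [J J = -1]
   produces the sign. *)
transitivity (\sum_i \sum_k J k i *: (row k P *m J *m N i)).
  apply: eq_bigr => i _.
  have -> : row i P = \sum_k J k i *: (row k P *m J).
    rewrite -{1}JPJ -mulmxA row_mul mulmx_sum_row; apply: eq_bigr => k _.
    by rewrite row_mul !mxE.
  by rewrite mulmx_suml; apply: eq_bigr => k _; rewrite -scalemxAl.
rewrite exchange_big/= -sumrN; apply: eq_bigr => k _.
under eq_bigr => i _ do rewrite scalemxAr.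
by rewrite -mulmx_sumr NJ mulmxA -(mulmxA _ J J) JJ mulmxN mulmx1 mulNmx.
Qed.

(** The middle term contracts to the trace of [N], which is zero. The outer two agree because the
    symmetry of [N] exchanges the direction of differentiation with the argument [X]. *)
Lemma divergence_eq0 (X : 'rV[R]_d) :
  \sum_i row i P *m (\tr (P *m N i *m H *m W^T) *: G
    - N i *m H *m W^T - W *m H *m (N i)^T) *m X^T = 0.
Proof.
under eq_bigr => i _ do rewrite !mulmxBr !mulmxBl.
rewrite !sumrB.
have -> : \sum_i row i P *m (N i *m H *m W^T) *m X^T = 0.
  transitivity ((\sum_i row i P *m N i) *m (H *m W^T *m X^T)).
    by rewrite mulmx_suml; apply: eq_bigr => i _; rewrite !mulmxA.
  by rewrite trace_eq0 mul0mx.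
rewrite subr0; apply/eqP; rewrite subr_eq0; apply/eqP.
transitivity ((\sum_i X 0 i * \tr (P *m N i *m H *m W^T))%:M : 'M[R]_1).
  rewrite raddf_sum/=; apply: eq_bigr => i _.
  rewrite -scalemxAr -row_mul PG -scalemxAl row1 -rowE.
  apply/matrixP => a b; rewrite !mxE !ord1 eqxx mulr1n mulrC; congr (_ * _).
(* Both sides are brought to the sum over [i, k, l] of [X_k P_il <W_l, N_k(d_i)>]. *)
transitivity (\sum_i \sum_k X 0 k *: (row i P *m W *m H *m (row i (N k))^T)).
  rewrite exchange_big/= raddf_sum/=; apply: eq_bigr => k _.
  rewrite -scaler_sumr -scale_scalar_mx; congr (_ *: _).
  rewrite -mxtrace_tr !trmx_mul trmxK symP symH !mulmxA mxtrace_mulC !mulmxA.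
  apply/matrixP => a b; rewrite !ord1 summxE !mxE eqxx mulr1n.
  apply: eq_bigr => i _; rewrite -!row_mul [LHS]mxE 2![RHS]mxE.
  by apply: eq_bigr => l _; rewrite !mxE.
apply: eq_bigr => i _.
rewrite -!mulmxA -trmx_mul.
have -> : (X *m N i)^T = \sum_k X 0 k *: (row i (N k))^T.
  rewrite mulmx_sum_row raddf_sum/=; apply: eq_bigr => k _.
  by rewrite linearZ/= symN.
rewrite !mulmx_sumr; apply: eq_bigr => k _.
by rewrite -!scalemxAr !mulmxA.
Qed.

End Divergence.

(** * Pluriharmonicity in real terms *)

Section Pluriharmonic.
Context {R : realType} (m n : nat).
Variables (g : 'rV[R]_(m + m) -> 'M[R]_(m + m)).
Variables (h : 'rV[R]_(n + n) -> 'M[R]_(n + n)).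
Variables (F : 'rV[R]_(m + m) -> 'rV[R]_(n + n)) (x : 'rV[R]_(m + m)).
Let B i := cov1 g h F (jacobian F) i x.
Let J := J0 R m.

Lemma J0_sqr : J0 R m *m J0 R m = - 1%:M.
Proof.
rewrite /J0 mulmx_block !mul0mx !mulmx0 !mul1mx !mulmx1 !addr0 !add0r.
by rewrite (scalar_mx_block m) opp_block_mx !oppr0.
Qed.

Lemma J0_tr : (J0 R m)^T = - J0 R m.
Proof.
by rewrite /J0 tr_block_mx opp_block_mx !trmx0 linearN/= trmx1 opprK !oppr0.
Qed.

(** The vector [u - i J u], twice the (1,0) part of [u]. *)
Let T10_vec (u : 'rV[R]_(m + m)) : 'rV[R[i]]_(m + m) :=
  \row_k (u 0 k -i* (u *m J) 0 k)%C.

Let T10_vecP u : T10 (T10_vec u).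
Proof.
have JJ : u *m J *m J = - u by rewrite -mulmxA J0_sqr mulmxN mulmx1.
apply/rowP => k; rewrite mxE [RHS]mxE [T10_vec _ _ _]mxE.
transitivity ((u *m J) 0 k -i* (u *m J *m J) 0 k)%C; last first.
  rewrite JJ [(- u) 0 k]mxE opprK; apply/eqP; rewrite eq_complex/=.
  by apply/andP; split; apply/eqP; ring.
rewrite mxE [X in (_ -i* X)%C]mxE.
apply/eqP; rewrite eq_complex; apply/andP; split; apply/eqP.
  rewrite (raddf_sum (@complex.Re R)) /=; apply: eq_bigr => l _.
  by rewrite !mxE/=; ring.
rewrite (raddf_sum (@complex.Im R)) /= -sumrN; apply: eq_bigr => l _.
by rewrite !mxE/=; ring.
Qed.

(** The imaginary part of [B(u - i J u, v + i J v)] is [B(u, J v) - B(J u, v)]; take coordinate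
    vectors for [u] and [v]. *)
Lemma pluriharmonicJ :
  (forall Z W, T10 Z -> T10 W ->
    second_fundC g h F x Z (map_mx (@conjc R) W) = 0) ->
  forall i, \sum_k J i k *: B k = J *m B i.
Proof.
move=> plurih i; apply/matrixP => j a.
have ImB (u v : 'rV[R]_(m + m)) :
    \sum_k u 0 k *: (v *m J *m B k) = \sum_k (u *m J) 0 k *: (v *m B k).
  apply/rowP => b; apply/eqP; rewrite -subr_eq0; apply/eqP.
  have /rowP/(_ b)/(congr1 (@complex.Im R)) :=
    plurih _ _ (T10_vecP u) (T10_vecP v).
  rewrite /second_fundC summxE mxE (raddf_sum (@complex.Im R))/= => E.
  rewrite -[RHS]E !summxE -sumrB; apply: eq_bigr => k _.
  rewrite [in RHS]mxE [in RHS]mxE [X in _ * X]mxE.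
  rewrite mulr_sumr (raddf_sum (@complex.Im R))/=.
  rewrite [X in X - _]mxE [X in _ - X]mxE.
  rewrite [X in _ * X - _]mxE [X in _ - _ * X]mxE.
  rewrite !mulr_sumr -sumrB; apply: eq_bigr => l _.
  have -> : (map_mx (@conjc R) (T10_vec v)) 0 l = (v 0 l +i* (v *m J) 0 l)%C.
    by rewrite mxE /T10_vec mxE /= opprK.
  rewrite [complexify _ _ _]mxE /real_complex_def -/(B k).
  move: ((u *m J) 0 k) ((v *m J) 0 l) (B k l b) => p q r /=.
  ring.
have := ImB (delta_mx 0 i) (delta_mx 0 j).
rewrite (bigD1 i)//= big1 => [|k /negbTE ki]; last first.
  by rewrite mxE eqxx/= ki scale0r.
rewrite addr0 mxE !eqxx scale1r -mulmxA -rowE => /rowP/(_ a).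
rewrite mxE => ->; rewrite !summxE; apply: eq_bigr => k _.
by rewrite -!rowE !mxE.
Qed.

End Pluriharmonic.


(** * The Levi-Civita connection at a point, and why [J] is parallel *)

Section Connection.
Context {R : realType} (d : nat) (G : 'M[R]_d) (D : 'I_d -> 'M[R]_d).

(* G and D i stand for a metric and its i-th partial derivative at a point;
   row j of connection i is the covariant derivative of the j-th coordinate
   field in the i-th direction. *)
Definition connection i : 'M[R]_d := \matrix_(j, k)
  (2^-1 * \sum_l invmx G k l * (D i j l + D j i l - D l i j)).

Hypotheses (symG : G^T = G) (unitG : G \in unitmx).
Hypothesis symD : forall i, (D i)^T = D i.

Lemma trmx_invmx_sym : (invmx G)^T = invmx G.
Proof. by rewrite trmx_inv symG. Qed.

(** Lowering the upper index gives the Christoffel symbols of the first kind, free of the inverse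
    metric. *)
Lemma connection_lower i : connection i *m G =
  \matrix_(j, k) (2^-1 * (D i j k + D j i k - D k i j)).
Proof.
set K := RHS; rewrite (_ : connection i = K *m invmx G) ?mulmxKV//.
apply/matrixP => j k; rewrite 2!mxE mulr_sumr.
apply: eq_bigr => l _; rewrite [K _ _]mxE -[in RHS]trmx_invmx_sym mxE.
by rewrite -mulrA [X in _ * X]mulrC.
Qed.

(** Compatibility with the metric: in the sum of two first-kind symbols the derivatives in
    directions [j] and [k] cancel. *)
Lemma connection_metric i : D i = connection i *m G + G *m (connection i)^T.
Proof.
rewrite -{2}symG -trmx_mul connection_lower; apply/matrixP => j k.
have DC : D i k j = D i j k by rewrite -[in LHS]symD mxE.
by rewrite !mxE DC; field.
Qed.

(** Vanishing torsion. *)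
Lemma connection_sym i j : row j (connection i) = row i (connection j).
Proof.
apply/rowP => k; rewrite !mxE; congr (_ * _); apply: eq_bigr => l _.
rewrite -[in LHS](symD l) [in LHS]mxE; congr (_ * _).
by congr (_ - _); rewrite addrC.
Qed.

Variable J : 'M[R]_d.
Hypotheses (trJ : J^T = - J) (JJ : J *m J = - 1%:M).
Hypotheses (JGJ : J *m G *m J^T = G) (JDJ : forall i, J *m D i *m J^T = D i).
Hypothesis closed : forall a b c,
  (J *m D a) b c + (J *m D b) c a + (J *m D c) a b = 0.

Let commJ (A : 'M[R]_d) : J *m A *m J^T = A -> J *m A = A *m J.
Proof.
move=> hA; rewrite -[in RHS]hA trJ mulmxN mulNmx -mulmxA JJ mulmxN mulmx1.
by rewrite opprK.
Qed.

Let JJE (A : 'M[R]_d) : J *m (J *m A) = - A.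
Proof. by rewrite mulmxA JJ mulNmx mul1mx. Qed.

(* d omega (J d_j, J d_k, d_i) = 0 rewritten in terms of the metric. *)
Let closedJ i j k :
  \sum_a J k a * D a i j - \sum_a J j a * D a k i + (J *m D i) j k = 0.
Proof.
(* [s0] is the closedness relation contracted twice with [J]; [s1], [s2], [s3] simplify its three
   terms by [J J = -1] and the invariance of [D]. *)
have s0 : \sum_a \sum_b J j a * (J k b *
    ((J *m D a) b i + (J *m D b) i a + (J *m D i) a b)) = 0.
  by rewrite big1// => a _; rewrite big1// => b _; rewrite closed !mulr0.
have s1 : \sum_a \sum_b J j a * (J k b * (J *m D a) b i) =
    - \sum_a J j a * D a k i.
  rewrite -sumrN; apply: eq_bigr => a _.
  transitivity (J j a * (J *m (J *m D a)) k i).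
    by rewrite [in RHS]mxE mulr_sumr.
  by rewrite JJE mxE mulrN.
have s2 : \sum_a \sum_b J j a * (J k b * (J *m D b) i a) =
    \sum_a J k a * D a i j.
  rewrite exchange_big/=; apply: eq_bigr => b _.
  rewrite -[in RHS]JDJ [in RHS]mxE mulr_sumr; apply: eq_bigr => a _.
  by rewrite [J^T _ _]mxE; ring.
have s3 : \sum_a \sum_b J j a * (J k b * (J *m D i) a b) = (J *m D i) j k.
  transitivity ((J *m (J *m D i) *m J^T) j k); last first.
    by rewrite JJE mulNmx trJ mulmxN opprK (commJ (JDJ i)).
  rewrite [RHS]mxE exchange_big/=; apply: eq_bigr => b _.
  rewrite mxE mulr_suml; apply: eq_bigr => a _.
  by rewrite [J^T _ _]mxE; ring.
rewrite -[RHS]s0 -s1 -s2 -s3 addrAC -!big_split/=; apply: eq_bigr => a _.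
rewrite -!big_split/=; apply: eq_bigr => b _; ring.
Qed.

(** As [J] is constant in the chart, this commutation says that [J] is parallel. With an index
    lowered by [G], the commutator is a combination of [closed] at [(i, j, k)] and its
    [J]-transformed version [closedJ]. *)
Lemma connectionJ i : connection i *m J = J *m connection i.
Proof.
suff : connection i *m J *m G = J *m connection i *m G.
  by move=> /(congr1 (mulmx^~ (invmx G))); rewrite /= !mulmxK.
rewrite -mulmxA (commJ JGJ) mulmxA -[RHS]mulmxA connection_lower.
apply/matrixP => j k.
have trJD a b c : (J *m D a) b c = - (J *m D a) c b.
  rewrite -[in LHS](trmxK (J *m D a)) trmx_mul symD trJ mulmxN.
  by rewrite -(commJ (JDJ a)) linearN/= 2!mxE.
have comm_entry : (J *m D i) j k = (D i *m J) j k by rewrite (commJ (JDJ i)).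
have DC a b c : D a b c = D a c b by rewrite -[in LHS]symD mxE.
have Jskew a b : J a b = - J b a.
  by have /matrixP/(_ b a) := trJ; rewrite !mxE.
pose Q j k := \sum_a J k a * D a i j.
have DJ j' k' : \sum_a D j' i a * J a k' = (J *m D j') i k'.
  by rewrite (commJ (JDJ j')) mxE.
set L := \matrix_(_, _) _.
have -> : (L *m J) j k = 2^-1 * ((D i *m J) j k + (J *m D j) i k + Q j k).
  rewrite -DJ /L /Q !mxE mulrDr mulrDr !mulr_sumr -!big_split/=.
  apply: eq_bigr => a _; rewrite mxE.
  rewrite (Jskew k); ring.
have -> : (J *m L) j k = 2^-1 * ((J *m D i) j k + Q k j + (J *m D k) i j).
  rewrite -DJ /L /Q !mxE mulrDr mulrDr !mulr_sumr -!big_split/=.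
  apply: eq_bigr => a _; rewrite mxE (DC a).
  rewrite (Jskew j); ring.
have := closed i j k; have := closedJ i j k.
have -> : \sum_a J j a * D a k i = Q k j.
  by apply: eq_bigr => a _; rewrite DC.
rewrite -/(Q j k) (trJD j) -comm_entry; lra.
Qed.

End Connection.


(** * Covariant derivatives in matrix form *)

Definition levi_civita (R : realType) (d : nat) (g : 'rV[R]_d -> 'M[R]_d) x :=
  connection (g x) (fun i => pder i g x).

Definition pullback_connection (R : realType) (d e : nat)
    (h : 'rV[R]_e -> 'M[R]_e) (F : 'rV[R]_d -> 'rV[R]_e) x i : 'M[R]_e :=
  \sum_b pder i F x 0 b *: levi_civita h (F x) b.

Lemma christoffelE (R : realType) (d : nat) (g : 'rV[R]_d -> 'M[R]_d) x i j k :
  christoffel g x i j k = levi_civita g x i j k.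
Proof. by rewrite mxE. Qed.

Lemma cov2E (R : realType) (d : nat) (g T : 'rV[R]_d -> 'M[R]_d) i x :
  cov2 g T i x = pder i T x - levi_civita g x i *m T x
                 - T x *m (levi_civita g x i)^T.
Proof.
apply/matrixP => j k; rewrite mxE [RHS]mxE [X in _ = X + _]mxE.
congr (_ + _ + _); rewrite [RHS]mxE mxE; congr (- _).
  by apply: eq_bigr => l _; rewrite christoffelE.
by apply: eq_bigr => l _; rewrite [_^T _ _]mxE -christoffelE mulrC.
Qed.

(** * The pull-back connection and the covariant derivative of the stress tensor *)

Section PullBack.
Context {R : realType} (d e : nat).
Variables (g : 'rV[R]_d -> 'M[R]_d) (h : 'rV[R]_e -> 'M[R]_e).
Variables (F : 'rV[R]_d -> 'rV[R]_e) (x : 'rV[R]_d).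

Lemma cov1E w i :
  cov1 g h F w i x = pder i w x - levi_civita g x i *m w x
                     + w x *m pullback_connection h F x i.
Proof.
apply/matrixP => j a; rewrite mxE [RHS]mxE [X in _ = X + _]mxE.
congr (_ + _ + _).
  rewrite [RHS]mxE mxE; congr (- _).
  by apply: eq_bigr => l _; rewrite christoffelE.
rewrite mxE exchange_big/=; apply: eq_bigr => c _.
rewrite summxE mulr_sumr; apply: eq_bigr => b _.
by rewrite mxE christoffelE; ring.
Qed.

Lemma jacobianE y i a : differentiable F y -> jacobian F y i a = pder i F y 0 a.
Proof. by move=> dF; rewrite /pder deriveEjacobian// -rowE [RHS]mxE. Qed.

(** Chain rule, with the derivative of [F] expanded in the coordinate basis. *)
Lemma derive_pullback i : differentiable F x -> differentiable h (F x) ->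
  is_derive x (delta_mx 0 i) (h \o F) (\sum_b pder i F x 0 b *: pder b h (F x)).
Proof.
move=> dF dh.
have dhF : differentiable (h \o F) x by exact: differentiable_comp.
apply: DeriveDef; first exact: diff_derivable.
rewrite deriveE// diff_comp//= -(deriveE _ dF) -/(pder i F x).
rewrite [X in 'd _ _ X](row_sum_delta (pder i F x)) linear_sum/=.
by apply: eq_bigr => b _; rewrite linearZ/= -deriveE.
Qed.

Hypothesis symG : (g x)^T = g x.
Hypothesis compat : forall i,
  pder i g x = levi_civita g x i *m g x + g x *m (levi_civita g x i)^T.
Hypothesis posG : \forall y \near x, (g y)^T = g y /\
  forall u, u != 0 -> 0 < inner (g y) u u.
Hypotheses (dg : differentiable g x) (dF : differentiable F x).
Hypothesis dh : differentiable h (F x).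
Hypothesis symH : (h (F x))^T = h (F x).
Hypothesis compatH : forall b, pder b h (F x) =
  levi_civita h (F x) b *m h (F x) + h (F x) *m (levi_civita h (F x) b)^T.

(** The pull-back connection preserves the pull-back metric: contract [compatH] with the derivative
    of [F]. *)
Lemma pullback_metric i : \sum_b pder i F x 0 b *: pder b h (F x) =
  pullback_connection h F x i *m h (F x) +
  h (F x) *m (pullback_connection h F x i)^T.
Proof.
rewrite /pullback_connection mulmx_suml raddf_sum/= mulmx_sumr -big_split/=.
apply: eq_bigr => b _.
by rewrite compatH scalerDr -scalemxAl linearZ/= -scalemxAr.
Qed.

(** Leibniz rule. Since both connections are metric, the connection terms from differentiating [g]
    and [h \o F] combine with the partial derivative of [w] into its covariant derivative [N]. *)
Lemma cov2_stress w i : derivable w x (delta_mx 0 i) ->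
  let N := cov1 g h F w i x in
  cov2 g (stress g h F w) i x =
    \tr (invmx (g x) *m N *m h (F x) *m (w x)^T) *: g x
    - N *m h (F x) *m (w x)^T - w x *m h (F x) *m N^T.
Proof.
move=> /derivableP; rewrite -/(pder i w x) => dw N.
pose G := g x; pose P := invmx G; pose H := h (F x); pose W := w x.
pose Gam := levi_civita g x i; pose Del := pullback_connection h F x i.
have uG : G \in unitmx.
  by have [_] := nbhs_singleton posG; exact: positive_unitmx.
have symP : P^T = P by rewrite trmx_inv symG.
pose K y := w y *m (h \o F) y *m (w y)^T.
have dGd : is_derive x (delta_mx 0 i) g (Gam *m G + G *m Gam^T).
  by rewrite -compat; exact/derivableP/diff_derivable.
have dH : is_derive x (delta_mx 0 i) (h \o F) (Del *m H + H *m Del^T).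
  by rewrite -pullback_metric; exact: derive_pullback.
have EN : N = pder i w x - Gam *m W + W *m Del by rewrite /N cov1E.
have ENd : pder i w x = N + Gam *m W - W *m Del.
  by rewrite EN addrAC addrK subrK.
(* [K] is the matrix of [<w(d_j), w(d_k)>]. The terms in [Del] cancel; those in [Gam] survive until
   [cov2] subtracts them. *)
have dK : is_derive x (delta_mx 0 i) K
    (N *m H *m W^T + W *m H *m N^T + Gam *m K x + K x *m Gam^T).
  apply: is_derive_eq
    (is_derive_mulmx (is_derive_mulmx dw dH) (is_derive_trmx dw)) _.
  rewrite ENd /K /= -/W -/H -/G.
  rewrite [(_ - _)^T]linearB/= [(_ + _)^T]linearD/= !trmx_mul.
  rewrite !(mulmxDl, mulmxDr, mulNmx, mulmxN, mulmxA).
  (* Naming the products leaves an additive identity, which can be checked entry by entry. *)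
  move: (N *m H *m W^T) (Gam *m W *m H *m W^T) (W *m Del *m H *m W^T)
    (W *m H *m Del^T *m W^T) (W *m H *m N^T) (W *m H *m W^T *m Gam^T)
    => a1 a2 a3 a4 a5 a6.
  by apply/matrixP => r c; rewrite !mxE; ring.
(* The derivative of [|w|^2] is [2 <N, w>]: the [Gam] terms of [K] cancel those of the inverse
   metric. *)
have dnu : is_derive x (delta_mx 0 i) (fun y => \tr (invmx (g y) *m K y))
    (2 * \tr (P *m N *m H *m W^T)).
  have uGn : \forall y \near x, g y \in unitmx.
    near=> y.
    have [sG pG] : (g y)^T = g y /\ (forall u, u != 0 -> 0 < inner (g y) u u).
      by near: y.
    exact: positive_unitmx.
  apply: is_derive_eq
    (is_derive_mxtrace (is_derive_mulmx (is_derive_invmx uGn dGd) dK)) _.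
  rewrite -/G -/P.
  have -> : P *m (Gam *m G + G *m Gam^T) *m P = P *m Gam + Gam^T *m P.
    by rewrite mulmxDr mulmxDl !mulmxA mulVmx// mul1mx mulmxK.
  rewrite mulNmx mulmxDl !mulmxDr !mxtraceD raddfN/= mxtraceD.
  have -> : \tr (P *m (W *m H *m N^T)) = \tr (P *m N *m H *m W^T).
    rewrite -mxtrace_tr !trmx_mul trmxK symP symH mxtrace_mulC.
    by rewrite !mulmxA.
  have -> : \tr (P *m (K x *m Gam^T)) = \tr (Gam^T *m P *m K x).
    by rewrite mulmxA mxtrace_mulC mulmxA.
  rewrite !mulmxA.
  move: (\tr _) (\tr _) (\tr _) => a1 a2 a3; ring.
have nuE : \forall y \near x, (\tr (invmx (g y) *m K y) / 2) *: g y - K y =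
    stress g h F w y.
  near=> y.
  have [sG pG] : (g y)^T = g y /\ (forall u, u != 0 -> 0 < inner (g y) u u).
    by near: y.
  apply/matrixP => j k; rewrite [RHS]mxE normsqE// inner_row.
  by rewrite mxE [X in X + _]mxE [X in _ + X]mxE.
have dS : is_derive x (delta_mx 0 i) (stress g h F w)
   (\tr (P *m N *m H *m W^T) *: G
    + (\tr (P *m K x) / 2) *: (Gam *m G + G *m Gam^T)
    - (N *m H *m W^T + W *m H *m N^T + Gam *m K x + K x *m Gam^T)).
  apply: near_eq_is_derive nuE _.
  have dnu2 : is_derive x (delta_mx 0 i) (fun y => \tr (invmx (g y) *m K y) / 2)
      (\tr (P *m N *m H *m W^T)).
    apply: is_derive_eq (is_deriveM dnu (is_derive_cst (2^-1 : R) x _)) _.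
    by rewrite scaler0 add0r /GRing.scale/= mulrA mulVf ?mul1r// pnatr_eq0.
  exact: is_deriveB (is_derive_scalemx dnu2 dGd) dK.
rewrite cov2E /pder (@derive_val _ _ _ _ _ _ _ dS) -(nbhs_singleton nuE).
rewrite -/G -/P -/H -/W -/Gam -/(K x).
rewrite !(mulmxDl, mulmxDr, mulNmx, mulmxN, mulmxA).
rewrite -!scalemxAl -!scalemxAr scalerDr.
move: (_ *: G) (_ *: (Gam *m G)) (_ *: (G *m Gam^T)) (Gam *m K x)
  (K x *m Gam^T) (N *m H *m W^T) (W *m H *m N^T) => a1 a2 a3 a4 a5 a6 a7.
by apply/matrixP => r c; rewrite !mxE; ring.
Unshelve. all: by end_near. Qed.

End PullBack.


(** * Partial derivatives, and the twist [X |-> a (X + b J X J')] behind sigma and tau *)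

Section PartialDerivative.
Context {R : realType} (d : nat) (V : normedModType R).
Implicit Types (F : 'rV[R]_d -> V) (x : 'rV[R]_d).

Lemma is_derive_pder F x i : differentiable F x ->
  is_derive x (delta_mx 0 i) F (pder i F x).
Proof. by move=> dF; exact/derivableP/diff_derivable. Qed.

Lemma pder_val F x i dF : is_derive x (delta_mx 0 i) F dF -> pder i F x = dF.
Proof. by move=> dFx; rewrite /pder derive_val. Qed.

End PartialDerivative.

Lemma is_derive_mx_comb (R : realType) (V : normedModType R) p q
    (A : V -> 'M[R]_(p, q)) x v dA (a b : R) (P : 'M[R]_p) (Q : 'M[R]_q) :
  is_derive x v A dA -> is_derive x v
    (fun y => a *: (A y + b *: (P *m A y *m Q)))
    (a *: (dA + b *: (P *m dA *m Q))).
Proof.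
move=> hA.
have hP : is_derive x v (fun y => P *m A y *m Q) (P *m dA *m Q).
  apply: is_derive_eq (is_derive_mulmx
    (is_derive_mulmx (is_derive_cst P x v) hA) (is_derive_cst Q x v)) _.
  by rewrite mul0mx add0r mulmx0 addr0.
have hZ (c : R) (B : V -> 'M[R]_(p, q)) dB : is_derive x v B dB ->
    is_derive x v (fun y => c *: B y) (c *: dB).
  move=> hB; apply: is_derive_eq (is_derive_scalemx (is_derive_cst c x v) hB) _.
  by rewrite scale0r add0r.
exact: hZ (is_deriveD hA (hZ _ _ _ hP)).
Qed.

(** The connection matrices commute with [J] and [J'], so covariant differentiation commutes with
    the twist. *)
Lemma commuting_twist (R : comPzRingType) p q (J Gam : 'M[R]_p)
    (J' Del : 'M[R]_q) (A W : 'M[R]_(p, q)) (a b : R) :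
  Gam *m J = J *m Gam -> J' *m Del = Del *m J' ->
  let T X := a *: (X + b *: (J *m X *m J')) in
  T A - Gam *m T W + T W *m Del = T (A - Gam *m W + W *m Del).
Proof.
move=> GJ DJ T; rewrite /T -scalemxAr -scalemxAl -scalerBr -scalerDr.
congr (_ *: _).
rewrite !(mulmxDr, mulmxDl) -scalemxAl -scalemxAr !(mulmxN, mulNmx) !mulmxA GJ.
rewrite -(mulmxA _ J') DJ !mulmxA.
move: (Gam *m W) (J *m A *m J') (J *m Gam *m W *m J') (W *m Del)
  (J *m W *m Del *m J') => a1 a2 a3 a4 a5.
by apply/matrixP => r c; rewrite !mxE; ring.
Qed.

(** Both sides are the value at [(u, v)] of one symmetric bilinear map; this handles the target's
    Christoffel term in the second fundamental form. *)
Lemma symmetric_contraction (R : comPzRingType) q (L : 'I_q -> 'M[R]_q)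
    (u v : 'rV[R]_q) : (forall k l, row k (L l) = row l (L k)) ->
  u *m (\sum_k v 0 k *: L k) = v *m (\sum_k u 0 k *: L k).
Proof.
move=> symL.
have E (y z : 'rV[R]_q) : y *m (\sum_k z 0 k *: L k) =
    \sum_k \sum_l (z 0 k * y 0 l) *: row l (L k).
  rewrite mulmx_sumr; apply: eq_bigr => k _.
  rewrite -scalemxAr mulmx_sum_row scaler_sumr.
  by apply: eq_bigr => l _; rewrite scalerA.
rewrite !E exchange_big/=; apply: eq_bigr => k _; apply: eq_bigr => l _.
by rewrite mulrC symL.
Qed.

Section Twist.
Context {R : comPzRingType} (p q : nat) (J : 'M[R]_p) (J' : 'M[R]_q).
Variables (B : 'I_p -> 'M[R]_(p, q)) (a b : R).
Hypothesis BJ : forall c, \sum_k J c k *: B k = J *m B c.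
Let T c := a *: (B c + b *: (J *m B c *m J')).

(** Contracting the direction index with [J] commutes with multiplication on either side, so the
    twist inherits [BJ]. *)
Lemma twist_type c : \sum_k J c k *: T k = J *m T c.
Proof.
have JBJ : J *m (J *m B c *m J') = J *m (\sum_k J c k *: B k) *m J'.
  by rewrite BJ !mulmxA.
rewrite /T -scalemxAr mulmxDr -scalemxAr JBJ -BJ.
rewrite mulmx_sumr mulmx_suml scaler_sumr -big_split/= scaler_sumr.
apply: eq_bigr => k _.
rewrite -scalemxAr -scalemxAl !(scalerDr, scalerA).
by congr (_ *: _ + _ *: _); ring.
Qed.

(** [BJ] moves [J] from one argument of [B] to the other, so [B(X, J Y)] is symmetric along with
    [B]. *)
Lemma twist_sym : (forall k l, row k (B l) = row l (B k)) ->
  forall k l, row k (T l) = row l (T k).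
Proof.
move=> symB.
have JB k l : row k (J *m B l) = row l (J *m B k).
  rewrite -BJ row_mul mulmx_sum_row linear_sum/=; apply: eq_bigr => o _.
  by rewrite linearZ/= symB !mxE.
move=> k l; rewrite /T !linearZ/= !linearD/= !linearZ/= symB.
by rewrite (row_mul k (_ *m _)) (row_mul l (_ *m _)) JB.
Qed.

End Twist.

(** * The Kähler metric in a chart *)

Section KahlerMetric.
Context {R : realType} {m : nat} (K : kahlerManifold R m).
Variables (i : chart_index K) (x : 'rV[R]_(m + m)).
Hypothesis hx : (chart i @` chart_dom i) x.
Let g := metric i.
Let J := J0 R m.

Lemma chart_image_near : \forall y \near x, (chart i @` chart_dom i) y.
Proof. by apply: open_nbhs_nbhs; split => //; exact: chart_img_open. Qed.

Lemma metric_near : \forall y \near x, (g y)^T = g y /\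
  forall u, u != 0 -> 0 < inner (g y) u u.
Proof.
near=> y; have hy : (chart i @` chart_dom i) y.
  by near: y; exact: chart_image_near.
by split; [exact: Defs.metric_sym hy|exact: metric_pos hy].
Unshelve. all: by end_near. Qed.

Lemma metric_differentiable : differentiable g x.
Proof. by have [+ _] := @metric_smooth _ _ K i 1%N; apply. Qed.

Let dg a : is_derive x (delta_mx 0 a) g (pder a g x).
Proof. exact/derivableP/diff_derivable/metric_differentiable. Qed.

(** The symmetry of [g] holds on an open set, so it may be differentiated. *)
Lemma metric_pder_sym a : (pder a g x)^T = pder a g x.
Proof.
have <- := @derive_val _ _ _ _ _ _ _ (is_derive_trmx (dg a)).
apply: near_eq_derive; near=> y.
by apply: Defs.metric_sym; near: y; exact: chart_image_near.
Unshelve. all: by end_near. Qed.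

Lemma metric_hermitianE y : (chart i @` chart_dom i) y -> J *m g y *m J^T = g y.
Proof.
move=> hy; apply/matrixP => a b.
have := metric_hermitian hy (delta_mx 0 a) (delta_mx 0 b).
rewrite -!rowE inner_row => ->.
rewrite /inner -rowE mxE (bigD1 b)//= big1 => [|c /negbTE cb].
  by rewrite !mxE !eqxx mulr1 addr0.
by rewrite !mxE cb mulr0.
Qed.

Lemma metric_pder_hermitian a : J *m pder a g x *m J^T = pder a g x.
Proof.
have h := is_derive_mulmx (is_derive_mulmx (is_derive_cst J x _) (dg a))
  (is_derive_cst J^T x _).
have := @derive_val _ _ _ _ _ _ _ h.
rewrite mul0mx add0r mulmx0 addr0 => <-.
apply: near_eq_derive; near=> y.
by apply: metric_hermitianE; near: y; exact: chart_image_near.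
Unshelve. all: by end_near. Qed.

(** The matrix of [J] is constant and passes through the partial derivatives. *)
Lemma metric_closedE a b c : (J *m pder a g x) b c + (J *m pder b g x) c a +
  (J *m pder c g x) a b = 0.
Proof.
have E l : pder l (fundamental_form g) x = J *m pder l g x.
  have h := is_derive_mulmx (is_derive_cst J x _) (dg l).
  by rewrite /pder (@derive_val _ _ _ _ _ _ _ h) mul0mx add0r.
have := metric_closed hx a b c; rewrite /= (E a) (E b) (E c); exact.
Qed.

Let symG : (g x)^T = g x. Proof. exact: Defs.metric_sym. Qed.

Let unitG : g x \in unitmx.
Proof. by apply: positive_unitmx => // u; exact: metric_pos. Qed.

Lemma levi_civita_metric a :
  pder a g x = levi_civita g x a *m g x + g x *m (levi_civita g x a)^T.
Proof. exact: connection_metric symG unitG metric_pder_sym a. Qed.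

Lemma levi_civita_sym a b :
  row b (levi_civita g x a) = row a (levi_civita g x b).
Proof. exact: connection_sym metric_pder_sym a b. Qed.

Lemma levi_civitaJ a : levi_civita g x a *m J = J *m levi_civita g x a.
Proof.
apply: (@connectionJ _ _ _ _ symG unitG metric_pder_sym) => //.
- exact: J0_tr.
- exact: J0_sqr.
- exact: metric_hermitianE.
- exact: metric_pder_hermitian.
- exact: metric_closedE.
Qed.

Lemma metric_inv_hermitian : J^T *m invmx (g x) *m J = invmx (g x).
Proof.
have JJ : J^T *m J = 1%:M by rewrite J0_tr mulNmx J0_sqr opprK.
have h : g x *m J^T = J^T *m g x.
  by rewrite -[in RHS](metric_hermitianE hx) !mulmxA JJ mul1mx.
have <- : invmx (g x) *m J^T = J^T *m invmx (g x).
  by rewrite -[LHS](mulmxK unitG) -(mulmxA _ J^T) -h mulKmx.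
by rewrite -mulmxA JJ mulmx1.
Qed.

End KahlerMetric.

(** * Local expression of a pluriharmonic map *)

Section Maps.
Context {R : realType} {m n : nat}.
Context {M : kahlerManifold R m} {N : kahlerManifold R n}.
Variables (f : M -> N) (i : chart_index M) (j : chart_index N).
Hypothesis f_smooth : smooth_map f.
Let U := chart i @` (chart_dom i `&` f @^-1` chart_dom j).
Let F := local_rep f i j.

(** Within the open chart image, [U] is the preimage of an open chart domain under the continuous
    map [f \o chart_inv i]. *)
Lemma open_local_dom : open U.
Proof.
have -> : U = (chart i @` chart_dom i) `&`
    [set y | chart_dom j (f (chart_inv i y))].
  apply/seteqP; split => [_ [p [ip jp] <-]|_ [[p ip <-]]]/=.
    by split; [exists p|rewrite /= chartK].
  by rewrite chartK// => jp; exists p.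
rewrite openE => y [hy jy]; rewrite /interior.
apply: filterI.
  by apply: open_nbhs_nbhs; split => //; exact: chart_img_open.
have /(_ (f @^-1` chart_dom j)) := chart_inv_continuous hy; apply.
have /(_ (chart_inv i y) (chart_dom j)) := f_smooth.1; apply.
by apply: open_nbhs_nbhs; split => //; exact: chart_dom_open.
Qed.

Variable p : M.
Hypotheses (ip : chart_dom i p) (jp : chart_dom j (f p)).
Let x := chart i p.
Let g := metric i.
Let h := metric j.

Let Ux : U x. Proof. by exists p. Qed.

Let ix : (chart i @` chart_dom i) x. Proof. by exists p. Qed.

Let jFx : (chart j @` chart_dom j) (F x).
Proof. by exists (f p) => //; rewrite /F /local_rep/= /x chartK. Qed.

Let nearU : \forall y \near x, U y.
Proof. by apply: open_nbhs_nbhs; split => //; exact: open_local_dom. Qed.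

Let smoothF : smooth_on U F. Proof. exact: f_smooth.2. Qed.

Let dF y : U y -> differentiable F y.
Proof. by have [+ _] := smoothF 1; apply. Qed.

Let dpF b y : U y -> differentiable (pder b F) y.
Proof. by have [_ /(_ b)[+ _]] := smoothF 2; apply. Qed.

Let cpF a b y : U y -> {for y, continuous (pder a (pder b F))}.
Proof. by have [_ /(_ b)[_ /(_ a)+]] := smoothF 2; apply. Qed.

(** The scalar [derive_comm] applied to each component; [entry] identifies the iterated derivatives
    on all of [U], which transfers continuity and derivability to the components. *)
Lemma pder_comm a b : pder a (pder b F) x = pder b (pder a F) x.
Proof.
apply/rowP => k.
have entry c e y : U y -> pder c (pder e F) y 0 k =
    'D_(delta_mx 0 c) ('D_(delta_mx 0 e) (fun z => F z 0 k)) y.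
  move=> Uy; have nU : \forall z \near y, U z.
    by apply: open_nbhs_nbhs; split => //; exact: open_local_dom.
  rewrite {1}/pder derive_mx; last exact/diff_derivable/dpF.
  rewrite mxE; apply: near_eq_derive; near=> z.
  have Uz : U z by near: z.
  by rewrite /pder derive_mx ?mxE//; exact/diff_derivable/dF.
have entryc c e : {for x, continuous
    ('D_(delta_mx 0 c) ('D_(delta_mx 0 e) (fun z => F z 0 k)))}.
  have h0 : {for x, continuous (fun y => pder c (pder e F) y 0 k)}.
    apply: (@continuous_comp _ _ _ (pder c (pder e F)) (fun v => v 0 k)).
      exact: cpF.
    exact: coord_continuous.
  rewrite /prop_for/continuous_at -entry//.
  have nE : \forall y \near x, pder c (pder e F) y 0 k =
      'D_(delta_mx 0 c) ('D_(delta_mx 0 e) (fun z => F z 0 k)) y.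
    by near=> y; apply: entry; near: y.
  exact: cvg_trans (near_eq_cvg nE) h0.
pose Fk z := F z 0 k.
have nd : \forall y \near x, [/\ derivable Fk y (delta_mx 0 b),
    derivable Fk y (delta_mx 0 a),
    derivable ('D_(delta_mx 0 b) Fk) y (delta_mx 0 a)
  & derivable ('D_(delta_mx 0 a) Fk) y (delta_mx 0 b)].
near=> y.
have Uy : U y by near: y.
have d1 e : derivable (fun z => F z 0 k) y (delta_mx 0 e).
  by apply: (derivable_mxP _ _ _).1; exact/diff_derivable/dF.
have d2 c e : derivable ('D_(delta_mx 0 e) (fun z => F z 0 k)) y (delta_mx 0 c).
  have nU : \forall z \near y, U z.
    by apply: open_nbhs_nbhs; split => //; exact: open_local_dom.
  apply: (@near_eq_derivable _ _ _ (fun z => pder e F z 0 k)).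
    near=> z; have Uz : U z by near: z.
    by rewrite /pder derive_mx ?mxE//; exact/diff_derivable/dF.
  by apply: (derivable_mxP _ _ _).1; exact/diff_derivable/dpF.
  exact: And4 (d1 b) (d1 a) (d2 a b) (d2 b a).
apply: etrans (entry a b x Ux) (etrans _ (esym (entry b a x Ux))).
exact: derive_comm nd (entryc a b) (entryc b a).
Unshelve. all: by end_near. Qed.

(* Otherwise failed unifications unfold partial derivatives down to limits. *)
#[local] Opaque pder.

Lemma jacobian_derive c : is_derive x (delta_mx 0 c) (jacobian F)
  (\matrix_(b, a) pder c (pder b F) x 0 a).
Proof.
have nJ : \forall y \near x, \matrix_(b, a) pder b F y 0 a = jacobian F y.
  near=> y; have Uy : U y by near: y.
  by apply/matrixP => b a; rewrite mxE (jacobianE _ _ (dF Uy)).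
apply: near_eq_is_derive nJ _.
apply/is_derive_mxP => b a; rewrite mxE.
under eq_fun do rewrite mxE.
have dp : is_derive x (delta_mx 0 c) (pder b F) (pder c (pder b F) x).
  exact/is_derive_pder/dpF.
exact: ((is_derive_mxP _ _ _ _).1 dp 0 a).
Unshelve. all: by end_near. Qed.

Let B c := cov1 g h F (jacobian F) c x.

Lemma row_jacobian b : row b (jacobian F x) = pder b F x.
Proof. by apply/rowP => a; rewrite mxE (jacobianE _ _ (dF Ux)). Qed.

(** Three separate symmetries: of the second partial derivatives, and of the torsion-free
    connections of [M] and of [N]. *)
Lemma second_fundamental_sym b c : row b (B c) = row c (B b).
Proof.
have rowE3 q r (A C E : 'M[R]_(q, r)) k :
    row k (A - C + E) = row k A - row k C + row k E.
  by apply/rowP => l; rewrite !mxE.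
have rowB k l : row k (B l) = row k (pder l (jacobian F) x)
    - row k (levi_civita g x l *m jacobian F x)
    + row k (jacobian F x *m pullback_connection h F x l).
  exact: etrans (congr1 (row k) (cov1E _ _ _ _ _ _)) (rowE3 _ _ _ _ _ _).
have eq3 (u1 u2 u3 v1 v2 v3 : 'rV[R]_(n + n)) :
    u1 = v1 -> u2 = v2 -> u3 = v3 -> u1 - u2 + u3 = v1 - v2 + v3.
  by move=> -> -> ->.
apply: etrans (rowB b c) (etrans _ (esym (rowB c b))); apply: eq3.
- have pJ e := pder_val (jacobian_derive e).
  apply: etrans (congr1 (row b) (pJ c))
    (etrans _ (esym (congr1 (row c) (pJ b)))).
  by apply/rowP => a; rewrite 2![LHS]mxE 2![RHS]mxE (pder_comm c b).
- by rewrite !row_mul (levi_civita_sym ix).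
- rewrite (row_mul b) (row_mul c) (row_jacobian b) (row_jacobian c).
  rewrite /pullback_connection.
  apply: (symmetric_contraction (L := levi_civita h (F x))) => k l.
  exact: (levi_civita_sym jFx).
Qed.

Variable eps : R.
(** The values 1 and -1 of [eps] give sigma and tau, which are thus treated together. *)
Let w (G : 'rV[R]_(m + m) -> 'rV[R]_(n + n)) y : 'M[R]_(m + m, n + n) :=
  2^-1 *: (jacobian G y + eps *: (J0 R m *m jacobian G y *m J0 R n)).

Let dw c : is_derive x (delta_mx 0 c) (w F)
  (2^-1 *: (pder c (jacobian F) x
            + eps *: (J0 R m *m pder c (jacobian F) x *m J0 R n))).
Proof.
apply: is_derive_mx_comb.
by rewrite (pder_val (jacobian_derive c)); exact: jacobian_derive.
Qed.

Let cov1_w c :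
  cov1 g h F (w F) c x = 2^-1 *: (B c + eps *: (J0 R m *m B c *m J0 R n)).
Proof.
set Gam := levi_civita g x c; set Del := pullback_connection h F x c.
have GJ : Gam *m J0 R m = J0 R m *m Gam by exact: levi_civitaJ.
have DJ : J0 R n *m Del = Del *m J0 R n.
  rewrite /Del /pullback_connection mulmx_sumr mulmx_suml.
  apply: eq_bigr => b _.
  by rewrite -scalemxAl -scalemxAr (levi_civitaJ jFx).
have twist := commuting_twist (pder c (jacobian F) x) (jacobian F x)
  2^-1 eps GJ DJ.
apply: etrans (cov1E _ _ _ _ _ _) (etrans _ (etrans twist _)).
  by rewrite (pder_val (dw c)).
by rewrite -(cov1E g h F x (jacobian F) c).
Qed.

Hypothesis plurih : forall Z W : 'rV[R[i]]_(m + m), T10 Z -> T10 W ->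
  second_fundC g h F x Z (map_mx (@conjc R) W) = 0.

Lemma div_stress_eq0 (X : 'rV[R]_(m + m)) : div g (stress g h F (w F)) x X = 0.
Proof.
have [symG posG] := nbhs_singleton (metric_near ix).
have uG := positive_unitmx symG posG.
rewrite divE//.
(* The existential hides the body of the covariant derivative, which is handled below as an abstract
   family. *)
have [Nab NabE] : exists Nab, forall c, cov1 g h F (w F) c x = Nab c.
  by exists (fun c => cov1 g h F (w F) c x).
have [symH posH] := nbhs_singleton (metric_near jFx).
have BJ := pluriharmonicJ plurih.
have NabB : Nab = fun c => 2^-1 *: (B c + eps *: (J0 R m *m B c *m J0 R n)).
  by apply/funext => c; apply: etrans (esym (NabE c)) (cov1_w c).
have NabJ c : \sum_k J0 R m c k *: Nab k = J0 R m *m Nab c.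
  by rewrite NabB; exact: (twist_type (J0 R n) 2^-1 eps BJ c).
have Nab_sym b c : row c (Nab b) = row b (Nab c).
  rewrite NabB.
  exact: (twist_sym (J0 R n) 2^-1 eps BJ second_fundamental_sym c b).
have E c : cov2 g (stress g h F (w F)) c x =
    \tr (invmx (g x) *m Nab c *m h (F x) *m (w F x)^T) *: g x
    - Nab c *m h (F x) *m (w F x)^T - w F x *m h (F x) *m (Nab c)^T.
  rewrite -(NabE c); apply: cov2_stress.
  - exact: symG.
  - exact: levi_civita_metric.
  - exact: metric_near.
  - exact: metric_differentiable.
  - exact: dF.
  - exact: metric_differentiable.
  - exact: symH.
  - exact: levi_civita_metric.
  - by have [] := dw c.
under eq_bigr => c _ do rewrite E.
rewrite (divergence_eq0 _ _ _ (J := J0 R m)) ?mxE//.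
- exact: mulVmx.
- by rewrite trmx_inv symG.
- exact: metric_inv_hermitian.
- exact: J0_sqr.
Qed.

End Maps.

Theorem proposition4p2 (R : realType) (m n : nat)
    (M : kahlerManifold R m) (N : kahlerManifold R n) (f : M -> N)
    (f_smooth : smooth_map f) (f_pluriharmonic : pluriharmonic f) :
  div_stress_zero (@sigma R m n) f /\ div_stress_zero (@tau R m n) f.
Proof.
split=> i j p ip jp X F.
- have -> : @sigma R m n F = fun y =>
      2^-1 *: (jacobian F y + 1 *: (J0 R m *m jacobian F y *m J0 R n)).
    by apply/funext => y; rewrite scale1r.
  exact: (div_stress_eq0 f_smooth ip jp _ (f_pluriharmonic i j p ip jp)).
- have -> : @tau R m n F = fun y =>
      2^-1 *: (jacobian F y + (-1) *: (J0 R m *m jacobian F y *m J0 R n)).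
    by apply/funext => y; rewrite scaleN1r.
  exact: (div_stress_eq0 f_smooth ip jp _ (f_pluriharmonic i j p ip jp)).
Qed.
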